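(* For every directed temporal graph $\mathcal{G}$, considered with strict temporal paths, there exist a simple and proper directed temporal graph $\mathcal{H}$ and a map $\sigma\colon V(\mathcal{G})\to V(\mathcal{H})$ such that for all $u,v\in V(\mathcal{G})$: $(u,v)\in\mathcal{R}(\mathcal{G})$ if and only if $(\sigma(u),\sigma(v))\in\mathcal{R}(\mathcal{H})$.
   Context: A directed temporal graph is a triple $(V,E,\lambda)$ with $V$ finite, $E\subseteq\{(u,v)\in V\times V:u\ne v\}$, and $\lambda$ assigning each arc a nonempty finite set of time labels; it is simple if every arc has exactly one label, and proper if no two distinct arcs incident to a common vertex share a label. A temporal path from $u$ to $v$ is a sequence $(e_1,t_1),\dots,(e_k,t_k)$, $k\ge1$, $t_i\in\lambda(e_i)$, with $e_1,\dots,e_k$ a directed path from $u$ to $v$ (distinct vertices) and $t_1\le\dots\le t_k$; it is strict if $t_1<\dots<t_k$. $\mathcal{R}(\mathcal{G})$ is the static directed graph on $V(\mathcal{G})$ with arc $(u,v)$, $u\ne v$, iff there is a strict temporal path from $u$ to $v$ in $\mathcal{G}$; $\mathcal{R}(\mathcal{H})$ is defined likewise (in a proper graph every temporal path is strict). *)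

(* Defs.v *)
From mathcomp Require Import all_boot.
From mathcomp Require Import finmap.

Set Implicit Arguments.
Unset Strict Implicit.
Unset Printing Implicit Defensive.

(* Time labels are natural numbers. The labelling is a total function for
   convenience; its values outside the arc set carry no meaning, and every
   notion below consults it on arcs only. *)
Record tgraph := TGraph {
  vertex : finType;
  arcs : {set vertex * vertex};
  labels : vertex * vertex -> {fset nat};
  arcs_loopless : forall e : vertex * vertex, e \in arcs -> e.1 != e.2;
  labels_nonempty : forall e : vertex * vertex, e \in arcs -> labels e != fset0
}.

Definition simple_tgraph (G : tgraph) : Prop :=
  forall e : vertex G * vertex G, e \in arcs G -> #|` labels e| = 1.

Definition incident (G : tgraph) (x : vertex G) (e : vertex G * vertex G) :
  bool := (x == e.1) || (x == e.2).

Definition proper_tgraph (G : tgraph) : Prop :=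
  forall (e f : vertex G * vertex G) (x : vertex G),
  e \in arcs G -> f \in arcs G -> e != f ->
  incident x e -> incident x f -> [disjoint labels e & labels f]%fset.

Fixpoint diwalk (V : eqType) (u v : V) (es : seq (V * V)) : bool :=
  if es is e :: es' then (e.1 == u) && diwalk e.2 v es' else u == v.

(* For a walk [es] from [u], the vertices visited are [u] followed by the
   heads [e.2] of its arcs. *)
Definition dipath (V : eqType) (u v : V) (es : seq (V * V)) : bool :=
  diwalk u v es && uniq (u :: [seq e.2 | e <- es]).

Definition temporal_path (G : tgraph) (u v : vertex G)
    (p : seq ((vertex G * vertex G) * nat)) : bool :=
  [&& p != [::],
      all (fun et => (et.1 \in arcs G) && (et.2 \in labels et.1)) p,
      dipath u v [seq et.1 | et <- p]
    & sorted leq [seq et.2 | et <- p]].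

Definition strict_temporal_path (G : tgraph) (u v : vertex G)
    (p : seq ((vertex G * vertex G) * nat)) : bool :=
  temporal_path u v p && sorted ltn [seq et.2 | et <- p].

(* The arc relation of the static digraph R(G) on the vertices of [G]. *)
Definition reach (G : tgraph) (u v : vertex G) : Prop :=
  u != v /\ exists p, strict_temporal_path u v p.

(* Main.v *)
Require Import Defs.
From mathcomp Require Import all_boot.
From mathcomp Require Import finmap.
From mathcomp Require Import zify.

(* Subdivide: every contact [(u, v)] at time [t] of [G] becomes its own
   two-arc path from [u] to [v] through a fresh vertex. The time axis is cut
   into blocks: block [2t] holds the first arcs and block [2t+1] the second
   arcs of the contacts at time [t], one slot per contact. All labels are then
   distinct, and a second arc of a contact at time [s] precedes a first arc of
   a contact at time [t] exactly when [s < t], which is strictness in [G]. *)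

Set Implicit Arguments.
Unset Strict Implicit.
Unset Printing Implicit Defensive.

(** Strictly increasing times are in particular weakly increasing, so the [sorted leq] clause is
    absorbed. *)
Lemma strict_temporal_pathE (G : tgraph) (u v : vertex G) p :
  strict_temporal_path u v p =
  [&& p != [::],
      all (fun et => (et.1 \in arcs G) && (et.2 \in labels et.1)) p,
      dipath u v [seq et.1 | et <- p]
    & sorted ltn [seq et.2 | et <- p]].
Proof.
rewrite /strict_temporal_path /temporal_path -!andbA.
case: (boolP (sorted ltn _)) => [lt_p|]; last by rewrite !andbF.
by rewrite (sub_sorted (fun m n => @ltnW m n) lt_p) !andbT.
Qed.

Section Subdivision.

Variable G : tgraph.
Local Notation V := (vertex G).

Definition contacts : seq ((V * V) * nat) :=
  [seq (e, t) | e <- enum (arcs G), t <- enum_fset (labels e)].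

Definition contact : finType := seq_sub contacts.

Lemma mem_contacts (et : (V * V) * nat) :
  (et \in contacts) = (et.1 \in arcs G) && (et.2 \in labels et.1).
Proof.
apply/allpairsPdep/andP => [[e [t [He Ht ->]]]|[He Ht]].
  by rewrite mem_enum in He.
by exists et.1, et.2; rewrite mem_enum; split=> //; case: (et).
Qed.

Definition ctail (i : contact) : V := (val i).1.1.
Definition chead (i : contact) : V := (val i).1.2.

Definition ctime (i : contact) : nat := (val i).2.

Definition early (i : contact) : nat :=
  (ctime i).*2 * #|contact| + enum_rank i.
Definition late (i : contact) : nat :=
  (ctime i).*2.+1 * #|contact| + enum_rank i.

Lemma early_lt_late i : early i < late i.
Proof.
by rewrite /early /late ltn_add2r ltn_mul2r ltnS leqnn andbT; apply/card_gt0P; exists i.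
Qed.

Lemma late_lt_early i j : (late i < early j) = (ctime i < ctime j).
Proof.
rewrite /early /late; move: (ltn_ord (enum_rank i)) (ltn_ord (enum_rank j)).
move: #|contact| (nat_of_ord _) (nat_of_ord _) => N ri rj ltri ltrj.
case: (ltnP (ctime i)) => [lt_ij|le_ji].
  (* [(ctime i).*2.+2 * N] is the end of the block containing [late i]. *)
  have : (ctime i).*2.+2 * N <= (ctime j).*2 * N by rewrite leq_mul2r; lia.
  lia.
have : (ctime j).*2 * N <= (ctime i).*2 * N by rewrite leq_mul2r; lia.
lia.
Qed.

(** Ranks are below [#|contact|], so block and slot are quotient and remainder of a Euclidean
    division. *)
Lemma block_inj (a b : nat) (i j : contact) :
  a * #|contact| + enum_rank i = b * #|contact| + enum_rank j -> a = b /\ i = j.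
Proof.
move=> E; have N0 : 0 < #|contact| by apply/card_gt0P; exists i.
split.
  have := congr1 (divn^~ #|contact|) E.
  by rewrite !divnMDl // !divn_small ?ltn_ord // !addn0.
have := congr1 (modn^~ #|contact|) E.
by rewrite !modnMDl !modn_small ?ltn_ord // => /val_inj/enum_rank_inj.
Qed.

Definition subdiv_vertex : finType := (V + contact)%type.
Local Notation W := subdiv_vertex.

Definition entry (i : contact) : W * W := (inl (ctail i), inr i).
Definition exit (i : contact) : W * W := (inr i, inl (chead i)).

Definition subdiv_arcs : {set W * W} :=
  [set entry i | i : contact] :|: [set exit i | i : contact].

(** The [0] is a default reached only on pairs that are not arcs. *)
Definition subdiv_time (e : W * W) : nat :=
  match e with
  | (inl _, inr i) => early i
  | (inr i, inl _) => late i
  | _ => 0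
  end.

Lemma subdiv_arcsP e :
  reflect (exists i, e = entry i \/ e = exit i) (e \in subdiv_arcs).
Proof.
apply: (iffP setUP) => [[]/imsetP[i _ ->]|[i [] ->]].
- by exists i; left.
- by exists i; right.
- by left; apply: imset_f.
- by right; apply: imset_f.
Qed.

Lemma subdiv_time_inj : {in subdiv_arcs &, injective subdiv_time}.
Proof.
move=> e f /subdiv_arcsP[i Hi] /subdiv_arcsP[j Hj].
(* An entry and an exit cannot share a label: their block numbers differ in parity. *)
by case: Hi => ->; case: Hj => -> /= /block_inj[E ->] //; lia.
Qed.

Lemma subdiv_loopless e : e \in subdiv_arcs -> e.1 != e.2.
Proof. by case/subdiv_arcsP => i [] ->. Qed.

Lemma subdiv_labels_nonempty e :
  e \in subdiv_arcs -> [fset subdiv_time e]%fset != fset0.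
Proof. by move=> _; apply/fset0Pn; exists (subdiv_time e); rewrite inE. Qed.

Definition subdivision : tgraph :=
  TGraph subdiv_loopless subdiv_labels_nonempty.

Lemma simple_subdivision : simple_tgraph subdivision.
Proof. by move=> e _; rewrite cardfs1. Qed.

Lemma proper_subdivision : proper_tgraph subdivision.
Proof.
move=> e f x eA fA ne_ef _ _; apply/fdisjointP => t; rewrite !inE => /eqP->.
by apply: contraNneq ne_ef => /subdiv_time_inj->.
Qed.

Definition expand (p : seq contact) : seq ((W * W) * nat) :=
  flatten [seq [:: (entry i, early i); (exit i, late i)] | i <- p].

Lemma diwalk_expand u v p :
  diwalk (inl u : W) (inl v) [seq et.1 | et <- expand p] =
  diwalk u v [seq et.1 | et <- map val p].
Proof.
elim: p u => [|i p IHp] u //=.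
by rewrite IHp (inj_eq (@inl_inj _ _)) eqxx.
Qed.

Lemma mem_heads_expand_inl v p :
  ((inl v : W) \in [seq et.1.2 | et <- expand p]) = (v \in [seq chead i | i <- p]).
Proof.
by elim: p => [|i p IHp] //=; rewrite !inE /= IHp (inj_eq (@inl_inj _ _)).
Qed.

Lemma mem_heads_expand_inr j p :
  ((inr j : W) \in [seq et.1.2 | et <- expand p]) = (j \in p).
Proof.
by elim: p => [|i p IHp] //=; rewrite !inE /= IHp (inj_eq (@inr_inj _ _)).
Qed.

(** A repeated contact already repeats its head, so distinctness of the fresh vertices adds no
    constraint. *)
Lemma uniq_heads_expand p :
  uniq [seq et.1.2 | et <- expand p] = uniq [seq chead i | i <- p].
Proof.
elim: p => [|i p IHp] //=.
rewrite inE /= mem_heads_expand_inr mem_heads_expand_inl IHp.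
case: (boolP (i \in p)) => // ip.
by rewrite (map_f chead ip).
Qed.

Lemma dipath_expand u v p :
  dipath (inl u : W) (inl v) [seq et.1 | et <- expand p] =
  dipath u v [seq et.1 | et <- map val p].
Proof.
rewrite /dipath diwalk_expand /= -!map_comp.
by rewrite mem_heads_expand_inl uniq_heads_expand.
Qed.

Lemma sorted_expand p :
  sorted ltn [seq et.2 | et <- expand p] =
  sorted ltn [seq et.2 | et <- map val p].
Proof.
(* Peeling off the first contact lets the induction carry the preceding contact [i]; the comparisons
   left are late to early, that is, between times of consecutive contacts. *)
case: p => [|i p] //=; rewrite early_lt_late /=.
by elim: p i => [|j p IHp] i //=; rewrite early_lt_late late_lt_early IHp.
Qed.

Lemma strict_temporal_path_expand u v p :
  strict_temporal_path (inl u : vertex subdivision) (inl v) (expand p) =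
  strict_temporal_path u v (map val p).
Proof.
rewrite !strict_temporal_pathE dipath_expand sorted_expand.
have -> : (expand p != [::]) = (map val p != [::]) by case: p.
have -> : all (fun et => (et.1 \in arcs subdivision) && (et.2 \in labels et.1))
    (expand p).
  apply/allP => et /flatten_mapP[i _]; rewrite in_cons mem_seq1.
  by case/orP => /eqP->; (apply/andP; split; last exact: fset11);
    apply/subdiv_arcsP; exists i; [left | right].
suff -> : all (fun et => (et.1 \in arcs G) && (et.2 \in labels et.1)) (map val p).
  by [].
by apply/allP => _ /mapP[i _ ->]; rewrite -mem_contacts; apply: valP.
Qed.

Lemma strict_temporal_path_contacts (u v : V) p :
  strict_temporal_path u v p -> exists q : seq contact, p = map val q.
Proof.
rewrite strict_temporal_pathE => /and4P[_ /allP Hp _ _].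
exists (pmap insub p); rewrite (pmap_filter (@insubK _ _ _)).
apply/esym/all_filterP/allP => et /Hp /=.
by rewrite -mem_contacts => Het; rewrite insubT.
Qed.

(** Arcs alternate between original and fresh vertices, and the only arc leaving [inr i] is
    [exit i]; a walk between original vertices thus splits into pairs [entry i], [exit i]. *)
Lemma subdivision_walk_expand (u v : V) q :
  all (fun et => (et.1 \in arcs subdivision) && (et.2 \in labels et.1)) q ->
  diwalk (inl u : W) (inl v) [seq et.1 | et <- q] ->
  exists p : seq contact, q = expand p.
Proof.
(* Induction on a size bound, since each step consumes two arcs. A single arc is impossible: one of
   its ends is fresh. *)
have [n] := ubnP (size q); elim: n u q => // n IHn u [|[e t] [|[f s] q]] /=; first by exists [::].
  by rewrite andbT => _ /andP[/subdiv_arcsP[i [] ->] _] /andP[].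
rewrite ltnS => /ltnW lt_q /and3P[/andP[eA et] /andP[fA fs] qA].
case/and3P => /eqP eu /eqP ef qW.
(* Label sets are singletons, so the arcs determine the times. *)
have {et} -> : t = subdiv_time e by apply/eqP; rewrite inE in et.
have {fs} -> : s = subdiv_time f by apply/eqP; rewrite inE in fs.
case/subdiv_arcsP: eA eu ef => i [] -> //= _ ef.
case/subdiv_arcsP: fA ef qW => j [] -> //= [->] qW.
by have [p ->] := IHn _ _ lt_q qA qW; exists (i :: p).
Qed.

End Subdivision.

Theorem theorem20 (G : tgraph) :
  exists (H : tgraph) (sigma : vertex G -> vertex H),
    simple_tgraph H /\ proper_tgraph H /\
    (forall u v : vertex G, reach u v <-> reach (sigma u) (sigma v)).
Proof.
exists (subdivision G), (fun v => inl v).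
split; first exact: simple_subdivision.
split; first exact: proper_subdivision.
(* Injectivity of [inl] matches the two [u != v] clauses; only paths remain to be translated. *)
move=> u v; rewrite /reach (inj_eq (@inl_inj _ _)).
split=> -[ne_uv [p pP]]; split=> //.
  have [q pq] := strict_temporal_path_contacts pP.
  by exists (expand q); rewrite strict_temporal_path_expand -pq.
have /and4P[_ pA /andP[pW _] _] := etrans (esym (strict_temporal_pathE _ _ _)) pP.
have [q pq] := subdivision_walk_expand pA pW.
by exists (map val q); rewrite -strict_temporal_path_expand -pq.
Qed.
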